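(* Let $X$ be a countably infinite set, let ${}_{\mathcal{L}}\mathbf{SBIA}_X$ be the free left-handed skew Boolean intersection algebra over $X$ and $\mathbf{GBA}_X$ the free generalized Boolean algebra over $X$. Then ${}_{\mathcal{L}}\mathbf{SBIA}_X/\mathcal{D}\simeq\mathbf{GBA}_X$.
   Context: A skew Boolean algebra (SBA) is an algebra $(S;\wedge,\vee,\setminus,0)$ of type $(2,2,2,0)$ satisfying: $\wedge$ and $\vee$ are associative; $x\vee(x\wedge y)=x=(y\wedge x)\vee x$ and $x\wedge(x\vee y)=x=(y\vee x)\wedge x$; $x\wedge(y\vee z)=(x\wedge y)\vee(x\wedge z)$ and $(y\vee z)\wedge x=(y\wedge x)\vee(z\wedge x)$; $x\vee 0=0\vee x=x$ and $x\wedge 0=0\wedge x=0$; $(x\setminus y)\wedge y=y\wedge(x\setminus y)=0$ and $(x\setminus y)\vee(x\wedge y\wedge x)=x=(x\wedge y\wedge x)\vee(x\setminus y)$; $x\wedge y\wedge z\wedge t=x\wedge z\wedge y\wedge t$. It is left-handed if also $x\wedge y\wedge x=x\wedge y$ and $x\vee y\vee x=y\vee x$. The natural partial order is: $x\leq y$ iff $x\wedge y=y\wedge x=x$. An SBA has intersections if any two elements $x,y$ have a greatest lower bound $x\sqcap y$ with respect to $\leq$; a (left-handed) skew Boolean intersection algebra (SBIA) is an algebra $(S;\wedge,\vee,\setminus,\sqcap,0)$ where $(S;\wedge,\vee,\setminus,0)$ is a (left-handed) SBA with intersections and $\sqcap$ is this meet operation. Left-handed SBIAs form a variety in the signature $(\wedge,\vee,\setminus,\sqcap,0)$;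 free algebras are free algebras in this variety. Generalized Boolean algebras (GBAs) are the commutative SBAs. The relation $\mathcal{D}$ is given by $x\mathrel{\mathcal{D}}y$ iff $x\wedge y\wedge x=x$ and $y\wedge x\wedge y=y$; it is a congruence on the reduct $(S;\wedge,\vee,\setminus,0)$, and $S/\mathcal{D}$ denotes the quotient of this reduct, a GBA. The isomorphism is one of GBAs. *)

(* Defs.v *)
From HB Require Import structures.
From mathcomp Require Import all_boot generic_quotient.
From mathcomp Require Import boolp classical_sets cardinality.

Set Implicit Arguments.
Unset Strict Implicit.
Unset Printing Implicit Defensive.

Declare Scope skew_scope.
Delimit Scope skew_scope with skew.
Local Open Scope quotient_scope.
Local Open Scope skew_scope.

Reserved Notation "x ⋏ y" (at level 40, left associativity).
Reserved Notation "x ⊓ y" (at level 40, left associativity).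
Reserved Notation "x ∖ y" (at level 40, left associativity).
Reserved Notation "x ⋎ y" (at level 50, left associativity).
Reserved Notation "x ≼ y" (at level 70, no associativity).

HB.mixin Record isSBA (S : Type) := {
  smeet : S -> S -> S;
  sjoin : S -> S -> S;
  sdiff : S -> S -> S;
  szero : S;
  smeetA : forall x y z, smeet x (smeet y z) = smeet (smeet x y) z;
  sjoinA : forall x y z, sjoin x (sjoin y z) = sjoin (sjoin x y) z;
  sjoinKl : forall x y, sjoin x (smeet x y) = x;
  sjoinKr : forall x y, sjoin (smeet y x) x = x;
  smeetKl : forall x y, smeet x (sjoin x y) = x;
  smeetKr : forall x y, smeet (sjoin y x) x = x;
  smeetDr : forall x y z, smeet x (sjoin y z) = sjoin (smeet x y) (smeet x z);
  smeetDl : forall x y z, smeet (sjoin y z) x = sjoin (smeet y x) (smeet z x);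
  sjoinx0 : forall x, sjoin x szero = x;
  sjoin0x : forall x, sjoin szero x = x;
  smeetx0 : forall x, smeet x szero = szero;
  smeet0x : forall x, smeet szero x = szero;
  sdiffKr : forall x y, smeet (sdiff x y) y = szero;
  sdiffKl : forall x y, smeet y (sdiff x y) = szero;
  sdiffJl : forall x y, sjoin (sdiff x y) (smeet (smeet x y) x) = x;
  sdiffJr : forall x y, sjoin (smeet (smeet x y) x) (sdiff x y) = x;
  snormal : forall x y z t,
    smeet (smeet (smeet x y) z) t = smeet (smeet (smeet x z) y) t
}.

#[short(type="sbaType")]
HB.structure Definition SBA := { S of isSBA S }.

Notation "x ⋏ y" := (smeet x y) : skew_scope.
Notation "x ⋎ y" := (sjoin x y) : skew_scope.
Notation "x ∖ y" := (sdiff x y) : skew_scope.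

Definition sle (S : sbaType) (x y : S) : Prop := x ⋏ y = x /\ y ⋏ x = x.
Notation "x ≼ y" := (sle x y) : skew_scope.

HB.mixin Record isLeftHanded S of SBA S := {
  smeet_lh : forall x y : S, x ⋏ y ⋏ x = x ⋏ y;
  sjoin_lh : forall x y : S, x ⋎ y ⋎ x = y ⋎ x
}.

#[short(type="lsbaType")]
HB.structure Definition LSBA := { S of isSBA S & isLeftHanded S }.

HB.mixin Record hasIntersections S of SBA S := {
  scap : S -> S -> S;
  scap_lel : forall x y : S, scap x y ≼ x;
  scap_ler : forall x y : S, scap x y ≼ y;
  scap_glb : forall x y z : S, z ≼ x -> z ≼ y -> z ≼ scap x y
}.

#[short(type="lsbiaType")]
HB.structure Definition LSBIA := { S of LSBA S & hasIntersections S }.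

Notation "x ⊓ y" := (scap x y) : skew_scope.

HB.mixin Record isCommutativeSBA S of SBA S := {
  smeetC : forall x y : S, x ⋏ y = y ⋏ x;
  sjoinC : forall x y : S, x ⋎ y = y ⋎ x
}.

#[short(type="gbaType")]
HB.structure Definition GBA := { S of isSBA S & isCommutativeSBA S }.

Definition sba_hom (S T : sbaType) (h : S -> T) : Prop :=
  [/\ forall x y, h (x ⋏ y) = h x ⋏ h y,
      forall x y, h (x ⋎ y) = h x ⋎ h y,
      forall x y, h (x ∖ y) = h x ∖ h y
    & h szero = szero].

Definition lsbia_hom (S T : lsbiaType) (h : S -> T) : Prop :=
  sba_hom h /\ forall x y, h (x ⊓ y) = h x ⊓ h y.

Definition free_lsbia (X : Type) (F : lsbiaType) (i : X -> F) : Prop :=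
  forall (A : lsbiaType) (f : X -> A),
    exists! h : F -> A, lsbia_hom h /\ forall x, h (i x) = f x.

Definition free_gba (X : Type) (F : gbaType) (i : X -> F) : Prop :=
  forall (A : gbaType) (f : X -> A),
    exists! h : F -> A, sba_hom h /\ forall x, h (i x) = f x.

Definition gba_iso (S T : gbaType) : Prop :=
  exists h : S -> T, sba_hom h /\ bijective h.

Definition Drel (S : sbaType) (x y : S) : Prop :=
  x ⋏ y ⋏ x = x /\ y ⋏ x ⋏ y = y.

Section QuotientByD.
Variable S : sbaType.
Implicit Types x y z t : S.

Lemma smeetxx x : x ⋏ x = x.
Proof. by rewrite -{2}(sjoinKl x x) smeetKl. Qed.

Lemma smeet_ins x y z : x ⋏ y ⋏ x ⋏ z = x ⋏ y ⋏ z.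
Proof. by rewrite snormal smeetxx. Qed.

Lemma Drel_refl x : Drel x x.
Proof. by split; rewrite !smeetxx. Qed.

Lemma Drel_sym x y : Drel x y -> Drel y x.
Proof. by case. Qed.

Lemma Drel_trans y x z : Drel x y -> Drel y z -> Drel x z.
Proof.
have half (a b c : S) : a ⋏ b ⋏ a = a -> b ⋏ c ⋏ b = b -> a ⋏ c ⋏ a = a.
  move=> ab bc.
  have acb : a ⋏ b ⋏ c ⋏ a = a.
    transitivity (a ⋏ (b ⋏ c ⋏ b) ⋏ a); last by rewrite bc.
    by rewrite !smeetA (snormal a b c b) -(smeetA _ b b) smeetxx snormal.
  have -> : a ⋏ c ⋏ a = a ⋏ b ⋏ a ⋏ c ⋏ a by rewrite ab.
  by rewrite smeet_ins acb.
by move=> [xy yx] [yz zy]; split; [apply: half xy yz | apply: half zy yx].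
Qed.

Lemma DrelM x x' y y' : Drel x x' -> Drel y y' -> Drel (x ⋏ y) (x' ⋏ y').
Proof.
have half (a a' b b' : S) : a ⋏ a' ⋏ a = a -> b ⋏ b' ⋏ b = b ->
    a ⋏ b ⋏ (a' ⋏ b') ⋏ (a ⋏ b) = a ⋏ b.
  move=> aa bb; rewrite !smeetA (snormal a b a' b').
  by rewrite -(smeetA _ b b') (snormal _ _ a b) aa -(smeetA a) bb.
by move=> [? ?] [? ?]; split; apply: half.
Qed.

(* Both sides of [a ⋏ b ⋏ a = a ⋏ a], for [a = x ⋎ y] and [b = x' ⋎ y'],
   distribute to the same join. *)
Lemma DrelJ x x' y y' : Drel x x' -> Drel y y' -> Drel (x ⋎ y) (x' ⋎ y').
Proof.
have half (a a' b b' : S) : a ⋏ a' ⋏ a = a -> b ⋏ b' ⋏ b = b ->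
    (a ⋎ b) ⋏ (a' ⋎ b') ⋏ (a ⋎ b) = a ⋎ b.
  move=> aa bb; rewrite -[RHS]smeetxx.
  have aca : a ⋏ (a' ⋎ b') ⋏ a = a ⋏ a.
    by rewrite smeetxx smeetDr smeetDl aa -smeetA sjoinKl.
  have bcb : b ⋏ (a' ⋎ b') ⋏ b = b ⋏ b.
    by rewrite smeetxx smeetDr smeetDl bb sjoinKr.
  have acb : a ⋏ (a' ⋎ b') ⋏ b = a ⋏ b.
    by rewrite -smeet_ins aca smeetxx.
  have bca : b ⋏ (a' ⋎ b') ⋏ a = b ⋏ a.
    by rewrite -smeet_ins bcb smeetxx.
  rewrite !(smeetDr _ a b) (smeetDl (a' ⋎ b')) (smeetDl a) (smeetDl b).
  by rewrite aca acb bca bcb -(smeetDl a) -(smeetDl b).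
by move=> [? ?] [? ?]; split; apply: half.
Qed.

Lemma DrelB x x' y y' : Drel x x' -> Drel y y' -> Drel (x ∖ y) (x' ∖ y').
Proof.
have half (a a' b b' : S) : Drel a a' -> Drel b b' ->
    (a ∖ b) ⋏ (a' ∖ b') ⋏ (a ∖ b) = a ∖ b.
  move=> [aa _] [_ bb]; set d := a ∖ b; set d' := a' ∖ b'.
  have da : d ⋏ a = d by rewrite -{1}(sdiffJl a b) smeetKl.
  have db' : d ⋏ b' = szero.
    by rewrite -bb !smeetA snormal sdiffKr !smeet0x.
  have da' : d ⋏ a' = d ⋏ d'.
    rewrite -[in LHS](sdiffJl a' b') smeetDr !smeetA (snormal d a' b' a').
    by rewrite db' !smeet0x sjoinx0.
  have dda : d ⋏ d' ⋏ a = d.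
    by rewrite -da' -{1}da -!smeetA (smeetA a) aa da.
  by rewrite -{2}da smeetA snormal smeetxx dda.
by move=> Dx Dy; split; apply: half => //; apply: Drel_sym.
Qed.

Definition Deq : rel {classic S} := fun x y => `[< @Drel S x y >].

Fact Deq_refl : reflexive Deq.
Proof. by move=> x; apply/asboolP/Drel_refl. Qed.

Fact Deq_sym : symmetric Deq.
Proof. by move=> x y; apply/asboolP/asboolP; apply: Drel_sym. Qed.

Fact Deq_trans : transitive Deq.
Proof.
by move=> y x z /asboolP xy /asboolP yz; apply/asboolP/(Drel_trans xy yz).
Qed.

Canonical Deq_equiv := EquivRel Deq Deq_refl Deq_sym Deq_trans.

(* The intersection plays no role here: D is in general not compatible with it,
   so a skew Boolean intersection algebra is first sent to its reduct. *)
Definition Dquot : Type := {eq_quot Deq_equiv}.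
Definition Dpi (x : S) : Dquot := \pi_({eq_quot Deq_equiv}) x.
Definition Drepr (c : Dquot) : S := repr (c : {eq_quot Deq_equiv}).

Definition Dmeet (c d : Dquot) : Dquot := Dpi (Drepr c ⋏ Drepr d).
Definition Djoin (c d : Dquot) : Dquot := Dpi (Drepr c ⋎ Drepr d).
Definition Ddiff (c d : Dquot) : Dquot := Dpi (Drepr c ∖ Drepr d).
Definition Dzero : Dquot := Dpi szero.

Lemma DpiP x y : Dpi x = Dpi y <-> Drel x y.
Proof.
have eqP := @eqmodP _ Deq_equiv x y.
by split=> [/eqP/asboolP | Dxy]; last by apply/eqP/asboolP.
Qed.

Lemma DreprK c : Dpi (Drepr c) = c.
Proof. exact: reprK. Qed.

Lemma DpiM x y : Dpi (x ⋏ y) = Dmeet (Dpi x) (Dpi y).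
Proof. by apply/DpiP/DrelM; apply/DpiP; rewrite DreprK. Qed.

Lemma DpiJ x y : Dpi (x ⋎ y) = Djoin (Dpi x) (Dpi y).
Proof. by apply/DpiP/DrelJ; apply/DpiP; rewrite DreprK. Qed.

Lemma DpiB x y : Dpi (x ∖ y) = Ddiff (Dpi x) (Dpi y).
Proof. by apply/DpiP/DrelB; apply/DpiP; rewrite DreprK. Qed.

Lemma Dquot_ind (P : Dquot -> Prop) : (forall x, P (Dpi x)) -> forall c, P c.
Proof. by move=> H c; rewrite -(DreprK c). Qed.

Let DpiE := (=^~ DpiM, =^~ DpiJ, =^~ DpiB).

Fact Dquot_isSBA : isSBA Dquot.
Proof.
exists Dmeet Djoin Ddiff Dzero; rewrite /Dzero;
  do ![elim/Dquot_ind=> ?]; rewrite !DpiE; congr Dpi.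
- exact: smeetA.
- exact: sjoinA.
- exact: sjoinKl.
- exact: sjoinKr.
- exact: smeetKl.
- exact: smeetKr.
- exact: smeetDr.
- exact: smeetDl.
- exact: sjoinx0.
- exact: sjoin0x.
- exact: smeetx0.
- exact: smeet0x.
- exact: sdiffKr.
- exact: sdiffKl.
- exact: sdiffJl.
- exact: sdiffJr.
- exact: snormal.
Defined.

HB.instance Definition _ := Dquot_isSBA.

Lemma DrelMC x y : Drel (x ⋏ y) (y ⋏ x).
Proof.
have half (a b : S) : a ⋏ b ⋏ (b ⋏ a) ⋏ (a ⋏ b) = a ⋏ b.
  by rewrite !smeetA -(smeetA a b b) smeetxx -(smeetA _ a a) smeetxx
             smeet_ins -smeetA smeetxx.
by split; apply: half.
Qed.

Lemma DrelJC x y : Drel (x ⋎ y) (y ⋎ x).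
Proof.
have half (a b : S) : (a ⋎ b) ⋏ (b ⋎ a) ⋏ (a ⋎ b) = a ⋎ b.
  rewrite -[RHS]smeetxx.
  have aca : a ⋏ (b ⋎ a) ⋏ a = a ⋏ a.
    by rewrite smeetDr smeetDl !smeetxx sjoinKr.
  have bcb : b ⋏ (b ⋎ a) ⋏ b = b ⋏ b by rewrite smeetKl.
  have acb : a ⋏ (b ⋎ a) ⋏ b = a ⋏ b by rewrite -smeet_ins aca smeetxx.
  have bca : b ⋏ (b ⋎ a) ⋏ a = b ⋏ a by rewrite smeetKl.
  rewrite !(smeetDr _ a b) (smeetDl (b ⋎ a)) (smeetDl a) (smeetDl b).
  by rewrite aca acb bca bcb -(smeetDl a) -(smeetDl b).
by split; apply: half.
Qed.

Fact Dquot_isCommutative : isCommutativeSBA Dquot.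
Proof.
split; do 2![elim/Dquot_ind=> ?].
  by rewrite /smeet /= !DpiE; apply/DpiP/DrelMC.
by rewrite /sjoin /= !DpiE; apply/DpiP/DrelJC.
Qed.

HB.instance Definition _ := Dquot_isCommutative.
End QuotientByD.

(* The free algebras exist, as terms modulo equality under every evaluation
   in every algebra of the class [car : K -> Type]. *)
Section TermQuotient.
Variables (O X K : Type) (car : K -> Type).
Variables (op : forall k, O -> car k -> car k -> car k).
Variables (zero : forall k, car k).

Inductive term := TVar of X | TZero | TOp of O & term & term.

Fixpoint teval k (f : X -> car k) (t : term) : car k :=
  match t with
  | TVar x => f x
  | TZero => zero k
  | TOp o s t => op o (teval f s) (teval f t)
  end.

Definition tequiv : rel {classic term} := fun s t =>
  `[< forall k (f : X -> car k), teval f s = teval f t >].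

Fact tequiv_refl : reflexive tequiv.
Proof. by move=> t; apply/asboolP. Qed.

Fact tequiv_sym : symmetric tequiv.
Proof. by move=> s t; apply/asboolP/asboolP=> E k f; rewrite E. Qed.

Fact tequiv_trans : transitive tequiv.
Proof.
by move=> t s u /asboolP st /asboolP tu; apply/asboolP=> k f; rewrite st.
Qed.

Canonical tequiv_equiv := EquivRel tequiv tequiv_refl tequiv_sym tequiv_trans.

Definition tquot : Type := {eq_quot tequiv_equiv}.
Definition tpi (t : term) : tquot := \pi_({eq_quot tequiv_equiv}) t.
Definition trepr (c : tquot) : term := repr (c : {eq_quot tequiv_equiv}).

Definition qeval k (f : X -> car k) (c : tquot) : car k := teval f (trepr c).
Definition qvar (x : X) : tquot := tpi (TVar x).
Definition qzero : tquot := tpi TZero.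
Definition qop (o : O) (c d : tquot) : tquot := tpi (TOp o (trepr c) (trepr d)).

Lemma qeval_pi k (f : X -> car k) t : qeval f (tpi t) = teval f t.
Proof.
have eqP := @eqmodP _ tequiv_equiv (trepr (tpi t)) t.
have /eqP/asboolP E := reprK (tpi t : {eq_quot tequiv_equiv}); exact: E.
Qed.

Lemma qeval_inj c d :
  (forall k (f : X -> car k), qeval f c = qeval f d) -> c = d.
Proof.
move=> E; have eqP := @eqmodP _ tequiv_equiv (trepr c) (trepr d).
have : tpi (trepr c) = tpi (trepr d) by apply/eqP/asboolP.
by rewrite /tpi /trepr !reprK.
Qed.

Lemma qeval_var k (f : X -> car k) x : qeval f (qvar x) = f x.
Proof. exact: qeval_pi. Qed.

Lemma qeval_zero k (f : X -> car k) : qeval f qzero = zero k.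
Proof. exact: qeval_pi. Qed.

Lemma qeval_op k (f : X -> car k) o c d :
  qeval f (qop o c d) = op o (qeval f c) (qeval f d).
Proof. exact: qeval_pi. Qed.

Lemma qeval_uniq k (f : X -> car k) (h : tquot -> car k) :
  (forall o c d, h (qop o c d) = op o (h c) (h d)) -> h qzero = zero k ->
  (forall x, h (qvar x) = f x) -> qeval f = h.
Proof.
move=> hop h0 hv; apply: funext => c.
have piK d : tpi (trepr d) = d by exact: reprK.
rewrite -(piK c) qeval_pi; elim: (trepr c) => [x||o s IHs t IHt] /=;
  rewrite -?hv -?h0 //.
rewrite IHs IHt -hop; congr h; apply: qeval_inj => k' g.
by rewrite qeval_op !qeval_pi.
Qed.
End TermQuotient.

Inductive sba_op := OMeet | OJoin | ODiff.

Definition sba_op_eval (S : sbaType) (o : sba_op) : S -> S -> S :=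
  match o with OMeet => smeet | OJoin => sjoin | ODiff => sdiff end.

(* [None] stands for the intersection. *)
Definition lsbia_op_eval (S : lsbiaType) (o : option sba_op) : S -> S -> S :=
  if o is Some o then sba_op_eval o else scap.

Definition lsbia_terms (X : Type) : Type :=
  @tquot _ X _ LSBIA.sort lsbia_op_eval (fun S => szero).

Definition gba_terms (X : Type) : Type :=
  @tquot _ X _ GBA.sort (fun S => @sba_op_eval S) (fun S => szero).

Section FreeAlgebras.
Variable X : Type.

Fact lsbia_terms_isSBA : isSBA (lsbia_terms X).
Proof.
exists (qop (Some OMeet)) (qop (Some OJoin)) (qop (Some ODiff)) (qzero _ _ _);
  move=> *; apply: qeval_inj => k f; rewrite !(qeval_op, qeval_zero) /=.
- exact: smeetA.
- exact: sjoinA.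
- exact: sjoinKl.
- exact: sjoinKr.
- exact: smeetKl.
- exact: smeetKr.
- exact: smeetDr.
- exact: smeetDl.
- exact: sjoinx0.
- exact: sjoin0x.
- exact: smeetx0.
- exact: smeet0x.
- exact: sdiffKr.
- exact: sdiffKl.
- exact: sdiffJl.
- exact: sdiffJr.
- exact: snormal.
Defined.
HB.instance Definition _ := lsbia_terms_isSBA.

Fact lsbia_terms_isLeftHanded : isLeftHanded (lsbia_terms X).
Proof.
split=> x y; apply: qeval_inj => k f; rewrite /smeet /sjoin /= !qeval_op /=.
  exact: smeet_lh.
exact: sjoin_lh.
Qed.
HB.instance Definition _ := lsbia_terms_isLeftHanded.

Lemma lsbia_terms_le (x y : lsbia_terms X) :
  x ≼ y <-> forall (k : lsbiaType) (f : X -> k), qeval f x ≼ qeval f y.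
Proof.
split=> [[xy yx] k f | H].
  split; [rewrite -[RHS](congr1 (qeval f) xy)
         | rewrite -[RHS](congr1 (qeval f) yx)];
  by rewrite [in RHS]/smeet /= qeval_op.
by split; apply: qeval_inj => k f; rewrite /smeet /= qeval_op /=;
  have [] := H k f.
Qed.

Fact lsbia_terms_hasIntersections : hasIntersections (lsbia_terms X).
Proof.
exists (qop None) => [x y|x y|x y z /lsbia_terms_le zx /lsbia_terms_le zy];
  apply/lsbia_terms_le => k f; rewrite qeval_op /=.
- exact: scap_lel.
- exact: scap_ler.
- by apply: scap_glb; [apply: zx | apply: zy].
Defined.
HB.instance Definition _ := lsbia_terms_hasIntersections.

Fact gba_terms_isSBA : isSBA (gba_terms X).
Proof.
exists (qop OMeet) (qop OJoin) (qop ODiff) (qzero _ _ _);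
  move=> *; apply: qeval_inj => k f; rewrite !(qeval_op, qeval_zero) /=.
- exact: smeetA.
- exact: sjoinA.
- exact: sjoinKl.
- exact: sjoinKr.
- exact: smeetKl.
- exact: smeetKr.
- exact: smeetDr.
- exact: smeetDl.
- exact: sjoinx0.
- exact: sjoin0x.
- exact: smeetx0.
- exact: smeet0x.
- exact: sdiffKr.
- exact: sdiffKl.
- exact: sdiffJl.
- exact: sdiffJr.
- exact: snormal.
Defined.
HB.instance Definition _ := gba_terms_isSBA.

Fact gba_terms_isCommutative : isCommutativeSBA (gba_terms X).
Proof.
split=> x y; apply: qeval_inj => k f; rewrite /smeet /sjoin /= !qeval_op /=.
  exact: smeetC.
exact: sjoinC.
Qed.
HB.instance Definition _ := gba_terms_isCommutative.

Lemma free_lsbia_exists : exists (F : lsbiaType) (i : X -> F), free_lsbia i.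
Proof.
exists (lsbia_terms X), (@qvar _ X _ _ _ _) => A f; exists (qeval f); split.
  split; last by move=> x; apply: qeval_var.
  split; last exact: (qeval_op f None).
  split; [exact: (qeval_op f (Some OMeet)) | exact: (qeval_op f (Some OJoin))
         | exact: (qeval_op f (Some ODiff))
         | exact: (@qeval_zero _ _ _ _ _ _ A f)].
move=> h [[[hM hJ hB h0] hI] hi]; apply: qeval_uniq => //.
by move=> [[]|] c d; [exact: hM | exact: hJ | exact: hB | exact: hI].
Qed.

Lemma free_gba_exists : exists (F : gbaType) (i : X -> F), free_gba i.
Proof.
exists (gba_terms X), (@qvar _ X _ _ _ _) => A f; exists (qeval f); split.
  split; last by move=> x; apply: qeval_var.
  split; [exact: (qeval_op f OMeet) | exact: (qeval_op f OJoin)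
         | exact: (qeval_op f ODiff) | exact: (@qeval_zero _ _ _ _ _ _ A f)].
move=> h [[hM hJ hB h0] hi]; apply: qeval_uniq => //.
by move=> [] c d; [exact: hM | exact: hJ | exact: hB].
Qed.
End FreeAlgebras.

(* Main.v *)
From HB Require Import structures.
Require Import Defs.
From mathcomp Require Import all_boot.
From mathcomp Require Import boolp classical_sets cardinality.
From Stdlib Require List.

Set Implicit Arguments.
Unset Strict Implicit.
Unset Printing Implicit Defensive.

(** Countable, atomless generalized Boolean algebras without a greatest element
    are unique up to isomorphism, by back-and-forth. Both F/D and G are such:
    an element c of a free algebra is the value of a term t, and a generator x
    not occurring in t can be sent anywhere while c is kept fixed. Sending x to
    c shows that c meets x nontrivially, sending x to 0 that c is not below x,
    and sending the other generators to 0 that x is not below c. *)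

(** * Invariants that determine the algebra up to isomorphism *)

Section Properties.
Local Open Scope skew_scope.
Variable S : sbaType.
Implicit Types x y : S.

(** Phrased through [⋏], [∖] and [szero] rather than through the order: the same condition then
    makes sense before commutativity is available and passes directly to the quotient by D. *)
Definition atomless := forall x, x <> szero ->
  exists y, x ⋏ y <> szero /\ x ∖ y <> szero.
Definition topless := forall x, exists y, y ∖ x <> szero.
Definition enumerable := exists e : nat -> S, forall x, exists n, e n = x.

End Properties.

(** * Relative complements and generated subalgebras in a generalized Boolean algebra *)

Section GBATheory.
Local Open Scope skew_scope.
Variable A : gbaType.
Implicit Types x y z u w : A.

Lemma sjoinxx x : x ⋎ x = x.
Proof. by rewrite -{2}(smeetxx x) sjoinKl. Qed.

Lemma smeetAC x y z : x ⋏ y ⋏ z = x ⋏ z ⋏ y.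
Proof. by rewrite -!smeetA (smeetC y). Qed.

Lemma sdiff_split x y : (x ⋏ y) ⋎ (x ∖ y) = x.
Proof. by have := sdiffJr x y; rewrite (smeetAC x) smeetxx. Qed.

(** Both relative complements equal their meet [u ⋏ (x ∖ y)], by distributivity. Most identities
    about [∖] below come from this uniqueness. *)
Lemma sdiff_unique x y u : (x ⋏ y) ⋎ u = x -> u ⋏ y = szero -> x ∖ y = u.
Proof.
move=> xE uy.
have ux : u ⋏ x = u by rewrite -xE sjoinC smeetKl.
have dx : (x ∖ y) ⋏ x = x ∖ y by rewrite -{2}(sdiff_split x y) sjoinC smeetKl.
transitivity (u ⋏ (x ∖ y)).
  rewrite -{1}dx -{2}xE smeetDr (smeetC x) smeetA sdiffKr smeet0x sjoin0x.
  exact: smeetC.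
rewrite -{2}ux -{2}(sdiff_split x y) smeetDr (smeetC x) smeetA uy.
by rewrite smeet0x sjoin0x.
Qed.

Lemma smeet_sdiffr x y z : z ⋏ (x ∖ y) = (z ⋏ x) ∖ y.
Proof.
symmetry; apply: sdiff_unique.
  by rewrite -smeetA -smeetDr sdiff_split.
by rewrite -smeetA sdiffKr smeetx0.
Qed.

Lemma smeet_sdiffl x y z : (x ∖ y) ⋏ z = (x ⋏ z) ∖ y.
Proof. by rewrite smeetC smeet_sdiffr smeetC. Qed.

Lemma sdiff_id x y : x ⋏ y = szero -> x ∖ y = x.
Proof. by move=> xy; apply: sdiff_unique; rewrite ?xy ?sjoin0x. Qed.

Lemma sdiff_eq0 x y : x ∖ y = szero <-> x ⋏ y = x.
Proof.
split=> [xy | xy]; first by rewrite -[RHS](sdiff_split x y) xy sjoinx0.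
by apply: sdiff_unique; rewrite ?smeet0x // sjoinx0.
Qed.

Lemma sdiff0x x : szero ∖ x = szero :> A.
Proof. by apply/sdiff_eq0; rewrite smeet0x. Qed.

Lemma sjoinACA x y z u : (x ⋎ y) ⋎ (z ⋎ u) = (x ⋎ z) ⋎ (y ⋎ u).
Proof. by rewrite -!sjoinA (sjoinA y) (sjoinC y) -sjoinA. Qed.

Lemma sdiffDl x y z : (x ⋎ y) ∖ z = (x ∖ z) ⋎ (y ∖ z).
Proof.
apply: sdiff_unique; first by rewrite smeetDl sjoinACA !sdiff_split.
by rewrite smeetDl !sdiffKr sjoinx0.
Qed.

Lemma sdiff_meet x y : x ∖ (x ⋏ y) = x ∖ y.
Proof.
apply: sdiff_unique; first by rewrite smeetA smeetxx sdiff_split.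
by rewrite (smeetC x) smeetA sdiffKr smeet0x.
Qed.

Lemma sdiffAC x y z : (x ∖ y) ∖ z = (x ∖ z) ∖ y.
Proof.
apply: sdiff_unique; first by rewrite smeet_sdiffl -sdiffDl sdiff_split.
by rewrite smeet_sdiffl sdiffKr sdiff0x.
Qed.

Lemma sdiff_lel x y : (x ∖ y) ⋏ x = x ∖ y.
Proof. by rewrite smeet_sdiffl smeetxx. Qed.

Lemma sdiff_eq x y : x ∖ y = szero -> y ∖ x = szero -> x = y.
Proof. by move=> /sdiff_eq0 xy /sdiff_eq0 yx; rewrite -xy smeetC yx. Qed.

Lemma sjoin_eq0 x y : x ⋎ y = szero <-> x = szero /\ y = szero.
Proof.
split=> [xy | [-> ->]]; last exact: sjoinx0.
by split; [rewrite -(smeetKl x y) | rewrite -(smeetKl y x) sjoinC]; rewrite xy smeetx0.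
Qed.

(** The element [x] does not cut [w]: it contains [w] or is disjoint from it. *)
Definition decides w x := w ⋏ x = w \/ w ⋏ x = szero.

Lemma decidesM w x y : decides w x -> decides w y -> decides w (x ⋏ y).
Proof.
by rewrite /decides smeetA => -[]-> wy //; right; rewrite smeet0x.
Qed.

Lemma decidesJ w x y : decides w x -> decides w y -> decides w (x ⋎ y).
Proof.
rewrite /decides smeetDr => -[]-> []->; rewrite ?sjoinx0 ?sjoin0x ?sjoinxx.
all: by auto.
Qed.

Lemma decidesB w x y : decides w x -> decides w y -> decides w (x ∖ y).
Proof.
rewrite /decides smeet_sdiffr => -[]->; last by right; rewrite sdiff0x.
by case=> [/sdiff_eq0 | /sdiff_id]; auto.
Qed.

Inductive sba_gen (P : A -> Prop) : A -> Prop :=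
| gen_base x of P x : sba_gen P x
| gen_zero : sba_gen P szero
| gen_meet x y of sba_gen P x & sba_gen P y : sba_gen P (x ⋏ y)
| gen_join x y of sba_gen P x & sba_gen P y : sba_gen P (x ⋎ y)
| gen_diff x y of sba_gen P x & sba_gen P y : sba_gen P (x ∖ y).

Lemma sba_gen_sub (P Q : A -> Prop) :
  (forall x, P x -> Q x) -> forall x, sba_gen P x -> sba_gen Q x.
Proof.
move=> PQ x; elim=> *; [exact/gen_base/PQ | exact: gen_zero | exact: gen_meet
  | exact: gen_join | exact: gen_diff].
Qed.

(** The elements that do not cut [w] form a subalgebra. *)
Lemma sba_gen_decides (P : A -> Prop) w :
  (forall x, P x -> decides w x) -> forall x, sba_gen P x -> decides w x.
Proof.
move=> Pw x; elim=> [|||| ] *; [exact: Pw | right; exact: smeetx0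
  | exact: decidesM | exact: decidesJ | exact: decidesB].
Qed.

(** The interval below [z] is a subalgebra. *)
Lemma sba_gen_le (P : A -> Prop) z :
  (forall x, P x -> x ⋏ z = x) -> forall x, sba_gen P x -> x ⋏ z = x.
Proof.
move=> Pz x; elim=> [y /Pz //||y y' _ yz _ y'z|y y' _ yz _ y'z|y y' _ yz _ _].
- exact: smeet0x.
- by rewrite -smeetA y'z.
- by rewrite smeetDl yz y'z.
- by rewrite smeet_sdiffl yz.
Qed.

End GBATheory.

(** * Binary products, the home of partial isomorphisms *)

Section Product.
Local Open Scope skew_scope.

Fact prod_isSBA (A B : sbaType) : isSBA (A * B)%type.
Proof.
exists (fun p q => (p.1 ⋏ q.1, p.2 ⋏ q.2)) (fun p q => (p.1 ⋎ q.1, p.2 ⋎ q.2))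
  (fun p q => (p.1 ∖ q.1, p.2 ∖ q.2)) (szero, szero);
  do ![case=> ? ?]; congr pair => /=.
all: try exact: smeetA.
all: try exact: sjoinA.
all: try exact: sjoinKl.
all: try exact: sjoinKr.
all: try exact: smeetKl.
all: try exact: smeetKr.
all: try exact: smeetDr.
all: try exact: smeetDl.
all: try exact: sjoinx0.
all: try exact: sjoin0x.
all: try exact: smeetx0.
all: try exact: smeet0x.
all: try exact: sdiffKr.
all: try exact: sdiffKl.
all: try exact: sdiffJl.
all: try exact: sdiffJr.
all: exact: snormal.
Defined.

HB.instance Definition _ (A B : sbaType) := prod_isSBA A B.

Fact prod_isCommutative (A B : gbaType) : isCommutativeSBA (A * B)%type.
Proof.
split=> -[a b] [c d]; congr pair; [exact: smeetC|exact: smeetC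
  |exact: sjoinC|exact: sjoinC].
Qed.

HB.instance Definition _ (A B : gbaType) := prod_isCommutative A B.

End Product.

(** * Back-and-forth between two countable algebras *)

Section BackAndForth.
Local Open Scope skew_scope.

(* Pairs are elements of the algebra A * B; a partial isomorphism is a subalgebra
   of A * B whose elements are all balanced. *)
Definition balanced (A B : gbaType) (p : A * B) := p.1 = szero <-> p.2 = szero.

(* Every atom of the subalgebra of the interval [0, z] cut out by [s] is
   balanced. *)
Fixpoint good (A B : gbaType) (s : seq (A * B)) (z : A * B) : Prop :=
  if s is p :: s then good s (z ⋏ p) /\ good s (z ∖ p) else balanced z.

(** The bound [z] replaces a greatest element: complements, and hence the cells cut out by [s],
    exist only relative to it. *)
Definition partial_iso (A B : gbaType) (s : seq (A * B)) :=
  exists2 z, good s z & forall p, List.In p s -> p ⋏ z = p.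

Section Pairs.
Variables A B : gbaType.
Implicit Types (p q z t w : A * B) (s : seq (A * B)).

Lemma balanced0 : balanced (szero : A * B).
Proof. by []. Qed.

Lemma balancedJ p q : balanced p -> balanced q -> balanced (p ⋎ q).
Proof.
move=> bp bq; rewrite /balanced; split=> /sjoin_eq0 [].
  by move=> /bp p0 /bq q0; apply/sjoin_eq0.
by move=> /bp p0 /bq q0; apply/sjoin_eq0.
Qed.

Lemma good0 s : good s szero.
Proof. by elim: s => //= p s IH; rewrite smeet0x sdiff0x. Qed.

(** Cutting distributes over joins, and joins of balanced pairs are balanced. *)
Lemma goodJ s z t : good s z -> good s t -> good s (z ⋎ t).
Proof.
elim: s z t => [|p s IH] z t /=; first exact: balancedJ.
by move=> [z1 z2] [t1 t2]; rewrite smeetDl sdiffDl; split; apply: IH.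
Qed.

Lemma good_disjoint s z :
  balanced z -> (forall p, List.In p s -> z ⋏ p = szero) -> good s z.
Proof.
move=> bz; elim: s => //= p s IH zs.
have zp : z ⋏ p = szero by apply: zs; left.
rewrite zp (sdiff_id zp); split; first exact: good0.
by apply: IH => q sq; apply: zs; right.
Qed.

(** Since [t] cuts no cell, [z ⋏ t] is a join of whole cells, each of them balanced. In the
    induction, a piece of [z ⋏ p] or of [z ∖ p] is automatically not cut by [p]. *)
Lemma good_balanced s z t : good s z ->
  (forall w, w ⋏ z = w -> (forall p, List.In p s -> decides w p) -> decides w t) ->
  balanced (z ⋏ t).
Proof.
elim: s z => [|p s IH] z /=.
  by move=> bz /(_ z (smeetxx z)) []// ->.
move=> [g1 g2] dt; rewrite -(sdiff_split z p) smeetDl; apply: balancedJ.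
  apply: IH g1 _ => w wzp ws; apply: dt => [|q [<-|/ws//]].
    by rewrite -wzp -smeetA (smeetAC z) smeetxx.
  by left; rewrite -wzp -!smeetA smeetxx.
apply: IH g2 _ => w wzp ws; apply: dt => [|q [<-|/ws//]].
  by rewrite -wzp -smeetA sdiff_lel.
by right; rewrite -wzp -smeetA sdiffKr smeetx0.
Qed.

Lemma partial_iso_balanced s t :
  partial_iso s -> sba_gen (fun p => List.In p s) t -> balanced t.
Proof.
move=> [z gz sz] st; rewrite -(sba_gen_le sz st) smeetC.
by apply: good_balanced gz _ => w _ ws; apply: sba_gen_decides ws _ st.
Qed.

(** The partner of [a] is chosen separately inside each cell, and the choices are joined. *)
Lemma good_extend s z a : atomless B -> good s z ->
  exists b, b ⋏ z.2 = b /\ good ((a, b) :: s) z.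
Proof.
move=> atB; elim: s z => [|p s IH] z /=.
  case: z => x y bz; have bz' : x = szero <-> y = szero := bz.
  (* In a single cell [(x, y)] the partner is zero if [a] misses [x], all of [y] if [a] covers [x],
     and otherwise a proper part of [y], which is nonzero because the cell is balanced. *)
  have [xa|xa] := pselect (x ⋏ a = szero).
    exists szero; split; first exact: smeet0x.
    rewrite /balanced /=; split; last first.
      by rewrite (sdiff_id xa) sdiff_id ?smeetx0.
    by split=> _ //; apply: smeetx0.
  have [xna|xna] := pselect (x ∖ a = szero).
    exists y; split; first exact: smeetxx.
    rewrite /balanced /=; split; last first.
      by split=> _ //; apply/sdiff_eq0/smeetxx.
    by rewrite smeetxx; have /sdiff_eq0-> := xna.
  have [|b [yb ynb]] := atB y.
    by move=> /bz' x0; apply: xa; rewrite x0 smeet0x.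
  exists (y ⋏ b); split; first by rewrite smeetAC smeetxx.
  rewrite /balanced /=; split; last by rewrite sdiff_meet.
  by rewrite smeetA smeetxx.
move=> [/IH [b1 [b1z [g11 g12]]] /IH [b2 [b2z [g21 g22]]]].
(* The elements [b1] and [b2] lie in the disjoint parts [z.2 ⋏ p.2] and [z.2 ∖ p.2], so neither
   disturbs the cuts made by the other. *)
exists (b1 ⋎ b2); split.
  rewrite smeetDl; congr sjoin.
    by rewrite -{1}b1z /= -smeetA (smeetAC z.2) smeetxx; apply: b1z.
  by rewrite -{1}b2z /= -smeetA sdiff_lel; apply: b2z.
have zb2 : z.2 ⋏ p.2 ⋏ b2 = szero.
  by rewrite -b2z (smeetC b2) /= smeetA -(smeetA z.2) sdiffKl smeetx0 smeet0x.
have zb1 : (z.2 ∖ p.2) ⋏ b1 = szero.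
  by rewrite -b1z (smeetC b1) /= (smeetC z.2 p.2) !smeetA sdiffKr !smeet0x.
have K1 : z ⋏ p ⋏ (a, b1 ⋎ b2) = z ⋏ p ⋏ (a, b1).
  by congr pair => /=; rewrite smeetDr zb2 sjoinx0.
have K2 : (z ∖ p) ⋏ (a, b1 ⋎ b2) = (z ∖ p) ⋏ (a, b2).
  by congr pair => /=; rewrite smeetDr zb1 sjoin0x.
(* The goal cuts by the new pair first and by [p] second, the induction hypotheses in the opposite
   order; cuts commute. *)
split; split.
- by rewrite smeetAC K1.
- by rewrite -smeet_sdiffl K2.
- by rewrite smeet_sdiffl -sdiff_meet K1 sdiff_meet.
- by rewrite sdiffAC -sdiff_meet K2 sdiff_meet.
Qed.

(** The bound is first enlarged so that its first component contains [a]; then [good_extend] applies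
    below the new bound. *)
Lemma partial_iso_extend s a : atomless B -> topless B ->
  partial_iso s -> exists b, partial_iso ((a, b) :: s).
Proof.
move=> atB topB [z gz sz].
(* The part of [a] outside [z.1] needs a partner outside [z.2], which exists as
   [B] has no greatest element. *)
have [b' [bal bz]] : exists b', balanced (a ∖ z.1, b') /\ b' ⋏ z.2 = szero.
  have [az|az] := pselect (a ∖ z.1 = szero).
    by exists szero; rewrite /balanced az smeet0x.
  have [b bz] := topB z.2.
  by exists (b ∖ z.2); split; [split | apply: sdiffKr].
set y := (_, b') in bal.
have yz : y ⋏ z = szero by congr pair => //=; apply: sdiffKr.
(* All pairs of [s] lie below [z], so [y] is disjoint from them and none of them cuts it. *)
have gzy : good s (z ⋎ y).
  apply: goodJ gz _; apply: good_disjoint bal _ => p /sz <-.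
  by rewrite (smeetC p) smeetA yz smeet0x.
have [b [bzy gb]] := good_extend a atB gzy.
exists b; exists (z ⋎ y) => // p [<-|/sz pz].
  congr pair => //=; rewrite smeetDr smeet_sdiffr smeetxx.
  exact: sdiff_split.
by rewrite smeetDr pz sjoinKl.
Qed.

(** Exchanging the factors turns the forth step into the back step. *)
Definition swap p : B * A := (p.2, p.1).

Lemma good_swap s z : good s z -> good (map swap s) (swap z).
Proof.
elim: s z => [|p s IH] z /=; first exact: iff_sym.
by move=> [/IH g1 /IH g2].
Qed.

Lemma partial_iso_swap s : partial_iso s -> partial_iso (map swap s).
Proof.
move=> [z gz sz]; exists (swap z); first exact: good_swap.
by move=> q /List.in_map_iff [p [<- /sz ps]]; rewrite -[in RHS]ps.
Qed.

End Pairs.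

Lemma partial_iso_step (A B : gbaType) (s : seq (A * B)) a b :
  atomless A -> topless A -> atomless B -> topless B -> partial_iso s ->
  exists s', [/\ partial_iso s', forall p, List.In p s -> List.In p s',
    exists d, List.In (a, d) s' & exists c, List.In (c, b) s'].
Proof.
move=> atA topA atB topB /(partial_iso_extend a atB topB) [d].
move=> /partial_iso_swap /(partial_iso_extend b atA topA) [c].
move=> /partial_iso_swap; rewrite [map _ _]/= -map_comp.
rewrite (_ : map _ s = s); last by rewrite -[RHS]map_id; apply: eq_map => -[].
move=> Hs; exists [:: (c, b), (a, d) & s]; split=> //=; first by auto.
  by exists d; auto.
by exists c; auto.
Qed.

(** Pairs of [R] with equal first components have differences with first component zero; by balance
    the second components of these differences vanish too, and symmetrically. So [R] is the graph of
    a bijection, and closure under the operations makes it a homomorphism. *)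
Lemma gba_iso_of_rel (A B : gbaType) (R : A * B -> Prop) :
  R szero ->
  (forall p q, R p -> R q -> [/\ R (p ⋏ q), R (p ⋎ q) & R (p ∖ q)]) ->
  (forall p, R p -> balanced p) ->
  (forall a, exists b, R (a, b)) -> (forall b, exists a, R (a, b)) ->
  gba_iso A B.
Proof.
move=> R0 Rop Rb /choice [h Rh] /choice [g Rg].
have Rinj p q : R p -> R q -> p.1 = q.1 <-> p.2 = q.2.
  move=> Rp Rq; have [_ _ /Rb pq] := Rop _ _ Rp Rq.
  have [_ _ /Rb qp] := Rop _ _ Rq Rp.
  have xx (T : gbaType) (x : T) : x ∖ x = szero by apply/sdiff_eq0/smeetxx.
  by split=> E; apply: sdiff_eq; [apply/pq | apply/qp | apply/pq | apply/qp];
    rewrite /= E xx.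
have hR a b : R (a, b) -> h a = b by move=> Rab; exact: (iffLR (Rinj _ _ (Rh a) Rab)).
exists h; split; last first.
  exists g => [a | b]; last exact: hR.
  exact: (iffRL (Rinj _ _ (Rg (h a)) (Rh a))).
split=> [a b|a b|a b|]; apply: hR; rewrite //;
  by have [] := Rop _ _ (Rh a) (Rh b).
Qed.

Lemma countable_atomless_topless_iso (A B : gbaType) :
  enumerable A -> atomless A -> topless A ->
  enumerable B -> atomless B -> topless B -> gba_iso A B.
Proof.
move=> [eA eAP] atA topA [eB eBP] atB topB.
pose st := {s : seq (A * B) | partial_iso s}.
pose mem (x : st) p := List.In p (projT1 x).
(* Stage [n] takes care of the [n]-th element of both enumerations at once. *)
have /choice [step stepP] : forall nx : nat * st, exists x : st,
    [/\ forall p, mem nx.2 p -> mem x p, exists d, mem x (eA nx.1, d)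
      & exists c, mem x (c, eB nx.1)].
  move=> [n [s ps]].
  have [s' [ps' ss' sA sB]] := partial_iso_step (eA n) (eB n) atA topA atB topB ps.
  by exists (exist _ s' ps').
have st0 : partial_iso ([::] : seq (A * B)) by exists szero => //; apply: balanced0.
pose chain := fix chain n : st :=
  if n is n.+1 then step (n, chain n) else exist _ _ st0.
have chainS m n p : m <= n -> mem (chain m) p -> mem (chain n) p.
  elim: n => [|n IH]; first by case: m.
  rewrite leq_eqVlt => /orP [/eqP-> // | /IH mn /mn].
  by have [H _ _] := stepP (n, chain n); apply: H.
(* The union of an increasing chain of subalgebras; any two of its elements share a stage. *)
pose R p := exists n, sba_gen (mem (chain n)) p.
apply: (@gba_iso_of_rel _ _ R).
- by exists 0; apply: gen_zero.
- move=> p q [m mp] [n nq].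
  have mp' : sba_gen (mem (chain (maxn m n))) p.
    by apply: sba_gen_sub mp => x; apply: chainS; apply: leq_maxl.
  have nq' : sba_gen (mem (chain (maxn m n))) q.
    by apply: sba_gen_sub nq => x; apply: chainS; apply: leq_maxr.
  by split; exists (maxn m n); [apply: gen_meet|apply: gen_join|apply: gen_diff].
- by move=> p [n]; apply: partial_iso_balanced; apply: (projT2 (chain n)).
- move=> a; have [n <-] := eAP a; have [_ [b H] _] := stepP (n, chain n).
  by exists b, n.+1; apply: gen_base.
- move=> b; have [n <-] := eBP b; have [_ _ [a H]] := stepP (n, chain n).
  by exists a, n.+1; apply: gen_base.
Qed.

End BackAndForth.

(** * Passage of the invariants to the quotient by D *)

Section Dquotient.
Local Open Scope skew_scope.
Variable S : sbaType.

(** The D-class of zero is a singleton, so nonvanishing conditions survive in the quotient. *)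
Lemma Dpi_eq0 (x : S) : Dpi x = szero <-> x = szero.
Proof.
split=> [/DpiP [] | -> //].
by rewrite smeetx0 smeet0x.
Qed.

Lemma Dquot_atomless : atomless S -> atomless (Dquot S).
Proof.
move=> atS; elim/Dquot_ind => x x0.
have [|y [xy xny]] := atS x; first by move=> /Dpi_eq0.
exists (Dpi y); split.
  by rewrite /smeet /= -DpiM => /Dpi_eq0.
by rewrite /sdiff /= -DpiB => /Dpi_eq0.
Qed.

Lemma Dquot_topless : topless S -> topless (Dquot S).
Proof.
move=> topS; elim/Dquot_ind => x; have [y yx] := topS x.
by exists (Dpi y); rewrite /sdiff /= -DpiB => /Dpi_eq0.
Qed.

Lemma Dquot_enumerable : enumerable S -> enumerable (Dquot S).
Proof.
move=> [e eP]; exists (@Dpi S \o e); elim/Dquot_ind => x.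
by have [n <-] := eP x; exists n.
Qed.

End Dquotient.

(** * The two-element algebra, a common test target for both varieties *)

Section Bool.
Local Open Scope skew_scope.

Fact bool_isSBA : isSBA bool.
Proof. by exists andb orb (fun a b => a && ~~ b) false; do ![case]. Defined.
HB.instance Definition _ := bool_isSBA.

Fact bool_isLeftHanded : isLeftHanded bool.
Proof. by split; do ![case]. Qed.
HB.instance Definition _ := bool_isLeftHanded.

Fact bool_isCommutative : isCommutativeSBA bool.
Proof. by split; do ![case]. Qed.
HB.instance Definition _ := bool_isCommutative.

Fact bool_hasIntersections : hasIntersections bool.
Proof. by exists andb; do ![case]; rewrite /sle //= => -[] // _ _ []. Defined.
HB.instance Definition _ := bool_hasIntersections.

End Bool.

(** * Fresh generators and enumeration of terms, uniformly in the signature *)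

Section Terms.
Local Open Scope classical_set_scope.
Variables (O X K : Type) (car : K -> Type).
Variables (op : forall k, O -> car k -> car k -> car k).
Variables (zero : forall k, car k).
Arguments op {k}.
Arguments zero {k}.

Let eval k (f : X -> car k) (t : term O X) := teval (@op) (@zero) f t.

Fixpoint tvars (t : term O X) : set X :=
  match t with
  | TVar x => [set x]
  | TZero => set0
  | TOp _ s t => tvars s `|` tvars t
  end.

Lemma finite_tvars t : finite_set (tvars t).
Proof.
by elim: t => [x||o s fs t ft] /=;
  [exact: finite_set1 | exact: finite_set0 | rewrite finite_setU].
Qed.

Lemma eq_teval k (f g : X -> car k) t :
  (forall x, tvars t x -> f x = g x) -> eval f t = eval g t.
Proof.
elim: t => [x||o s IHs t IHt] /= fg; [exact: fg | by [] |].
by rewrite /eval /= -!/(eval _ _) IHs ?IHt // => x xs; apply: fg; [right|left].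
Qed.

Definition op_hom k k' (h : car k -> car k') :=
  (forall o a b, h (op o a b) = op o (h a) (h b)) /\ h zero = zero.

Lemma op_hom_teval k k' (h : car k -> car k') f t :
  op_hom h -> h (eval f t) = eval (h \o f) t.
Proof.
move=> [ho h0]; elim: t => [x||o s IHs t IHt] //=.
by rewrite /eval /= ho -!/(eval _ _) IHs IHt.
Qed.

Lemma teval_zero k t : (forall o, op o zero zero = zero :> car k) ->
  eval (fun=> zero : car k) t = zero.
Proof.
move=> op0; elim: t => [x||o s IHs t IHt] //=.
by rewrite /eval /= -!/(eval _ _) IHs IHt.
Qed.

Variables (k : K) (i : X -> car k).
Hypothesis eval_surj : forall c, exists t, c = eval i t.

(** A term for [c] has finitely many variables, so some [x] is absent from it, and the value of [x]
    can be prescribed independently of [c]. *)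
Lemma term_fresh c : infinite_set [set: X] ->
  (forall k' (f : X -> car k'), exists h, op_hom h /\ forall x, h (i x) = f x) ->
  exists x, (forall e : car k, exists h : car k -> car k,
      [/\ op_hom h, h c = c & h (i x) = e]) /\
    forall k' (e : car k'), (forall o, op o zero zero = zero :> car k') ->
      exists h : car k -> car k', [/\ op_hom h, h c = zero & h (i x) = e].
Proof.
move=> Xinf ext; have [t ->] := eval_surj c.
have [x xt] : exists x, ~ tvars t x.
  apply: contrapT => /forallNP tX; apply: Xinf.
  by apply: sub_finite_set (finite_tvars t) => x _; apply: contrapT; apply: tX.
exists x; split=> [e | k' e op0].
  have [h [hh hi]] := ext k (fun y => if pselect (y = x) then e else i y).
  exists h; split=> //; last by rewrite hi; case: pselect.
  rewrite op_hom_teval //; apply: eq_teval => y yt /=; rewrite hi.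
  by case: pselect => // yx; case: xt; rewrite -yx.
(* All variables of [t] go to zero, and so does [t], as zero is closed under the operations. *)
have [h [hh hi]] := ext k' (fun y => if pselect (y = x) then e else zero).
exists h; split=> //; last by rewrite hi; case: pselect.
rewrite op_hom_teval // -(teval_zero t op0); apply: eq_teval => y yt /=.
by rewrite hi; case: pselect => // yx; case: xt; rewrite -yx.
Qed.

Lemma countable_terms_enumerable (g : O -> nat) : injective g ->
  countable [set: X] -> exists e : nat -> car k, forall c, exists n, e n = c.
Proof.
move=> g_inj /countable_injP [v v_inj].
have [pack pack_inj] : exists pack : seq nat -> nat, injective pack.
  by exists CodeSeq.code; apply: can_inj CodeSeq.codeK.
(* The lists have lengths 1, 0 and 3, which tells the constructors apart. *)
pose code := fix code (t : term O X) : nat := pack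
  match t with
  | TVar x => [:: v x]
  | TZero => [::]
  | TOp o s t => [:: g o; code s; code t]
  end.
have code_inj : injective code.
  elim=> [x||o s IHs t IHt] [y||o' s' t'] /= /pack_inj // [].
    by move=> /v_inj xy; congr TVar; apply: xy; rewrite in_setT.
  by move=> /g_inj -> /IHs -> /IHt ->.
(* Injectivity of [code] makes the value unambiguous; numbers that code no term get [zero]. *)
have /choice [e eP] : forall n, exists c, forall t, code t = n -> c = eval i t.
  move=> n; have [[t tn]|nt] := pselect (exists t, code t = n).
    by exists (eval i t) => t' t'n; congr eval; apply: code_inj; rewrite tn.
  by exists zero => t tn; case: nt; exists t.
exists e => c; have [t ->] := eval_surj c.
by exists (code t); apply: eP.
Qed.

End Terms.

(** * The invariants for free algebras *)

Section FreeProperties.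
Local Open Scope skew_scope.
Local Open Scope classical_set_scope.

(** The fresh generator [i x] is the witness for both properties: an element with a nonzero image
    under a homomorphism is nonzero. *)
Lemma fresh_atomless_topless (X : Type) (S : sbaType) (i : X -> S) :
  (forall c, exists x,
    (forall e : S, exists h : S -> S, [/\ sba_hom h, h c = c & h (i x) = e]) /\
    exists h : S -> bool, [/\ sba_hom h, h c = szero & h (i x) = true]) ->
  atomless S /\ topless S.
Proof.
move=> fresh; split=> [c c0 | c]; have [x [hS hb]] := fresh c; exists (i x).
  split.
    have [h [[hM _ _ h0] hc hx]] := hS c => /(congr1 h).
    by rewrite hM h0 hc hx smeetxx.
  have [h [[_ _ hB h0] hc hx]] := hS szero => /(congr1 h).
  rewrite hB h0 hc hx => cn; apply: c0.
  (* Here [c] is rebuilt from [c ∖ szero] and a meet with zero. *)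
  by rewrite -(sdiffJl c szero) cn smeetx0 smeet0x sjoinx0.
have [h [[_ _ hB h0] hc hx]] := hb => /(congr1 h).
by rewrite hB h0 hc hx.
Qed.

Definition sba_op_code (o : sba_op) : nat :=
  match o with OMeet => 0 | OJoin => 1 | ODiff => 2 end.

Lemma sba_op_code_inj : injective sba_op_code.
Proof. by do 2![case]. Qed.

Lemma sba_op_zero (S : sbaType) (o : sba_op) :
  sba_op_eval o (szero : S) szero = szero.
Proof.
case: o; [exact: smeetx0 | exact: sjoinx0 |].
by rewrite /= -[RHS](sdiffJl szero szero) smeetx0 sjoinx0.
Qed.

Lemma op_hom_sba (S T : sbaType) (h : S -> T) :
  (forall o a b, h (sba_op_eval o a b) = sba_op_eval o (h a) (h b)) ->
  h szero = szero -> sba_hom h.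
Proof.
by move=> ho h0; split=> //; [exact: (ho OMeet)|exact: (ho OJoin)|exact: (ho ODiff)].
Qed.

Variable X : Type.
Hypotheses (Xcount : countable [set: X]) (Xinf : infinite_set [set: X]).

Lemma free_lsbia_properties (F : lsbiaType) (i : X -> F) : free_lsbia i ->
  [/\ enumerable F, atomless F & topless F].
Proof.
move=> free.
(* The composite from [F] to the term algebra and back fixes the generators, so uniqueness in the
   universal property makes it the identity. *)
have surj (c : F) :
    exists t, c = teval (@lsbia_op_eval) (fun S : lsbiaType => szero) i t.
  have [h [[[[hM hJ hB h0] hI] hi] _]] := free (lsbia_terms X) (qvar _ _).
  exists (trepr (h c)); rewrite -[RHS]/(qeval i (h c)).
  have [g [_ guniq]] := free F i.
  transitivity (g c); first by rewrite (guniq id).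
  rewrite (guniq (qeval i \o h)) //; split; last first.
    by move=> x; rewrite /= hi; apply: qeval_var.
  split; last by move=> a b; rewrite /= hI; apply: (qeval_op i None).
  split=> [a b|a b|a b|] /=.
  - by rewrite hM; apply: (qeval_op i (Some OMeet)).
  - by rewrite hJ; apply: (qeval_op i (Some OJoin)).
  - by rewrite hB; apply: (qeval_op i (Some ODiff)).
  - by rewrite h0; apply: qeval_zero.
have ext (A : lsbiaType) (f : X -> A) : exists h : F -> A,
    op_hom (@lsbia_op_eval) (fun S : lsbiaType => szero) h /\
    forall x, h (i x) = f x.
  have [h [[[[hM hJ hB h0] hI] hi] _]] := free A f.
  by exists h; split=> //; split=> // -[[]|].
have sba (A B : lsbiaType) (h : A -> B) :
    op_hom (@lsbia_op_eval) (fun S : lsbiaType => szero) h -> sba_hom h.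
  by move=> [ho h0]; apply: op_hom_sba => // o; apply: (ho (Some o)).
have [|atF topF] := @fresh_atomless_topless X F i.
  move=> c; have [x [xF xb]] := term_fresh surj c Xinf ext.
  exists x; split.
    by move=> e; have [h [/sba]] := xF e; exists h.
  have [|h [/sba]] := xb bool true; last by exists h.
  by move=> [o|] //; apply: sba_op_zero.
split=> //.
(* Code 0 goes to the intersection, and the other codes are shifted by one. *)
apply: (countable_terms_enumerable surj (g := fun o => if o is Some o then
  (sba_op_code o).+1 else 0)) => //.
by move=> [o|] [o'|] // [/sba_op_code_inj ->].
Qed.

(** The argument for [free_lsbia_properties], run with the term algebra of the commutative
    variety. *)
Lemma free_gba_properties (G : gbaType) (j : X -> G) : free_gba j ->
  [/\ enumerable G, atomless G & topless G].
Proof.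
move=> free.
have surj (c : G) : exists t,
    c = teval (fun S : gbaType => @sba_op_eval S) (fun S : gbaType => szero) j t.
  have [h [[[hM hJ hB h0] hi] _]] := free (gba_terms X) (qvar _ _).
  exists (trepr (h c)); rewrite -[RHS]/(qeval j (h c)).
  have [g [_ guniq]] := free G j.
  transitivity (g c); first by rewrite (guniq id).
  rewrite (guniq (qeval j \o h)) //; split; last first.
    by move=> x; rewrite /= hi; apply: qeval_var.
  split=> [a b|a b|a b|] /=.
  - by rewrite hM; apply: (qeval_op j OMeet).
  - by rewrite hJ; apply: (qeval_op j OJoin).
  - by rewrite hB; apply: (qeval_op j ODiff).
  - by rewrite h0; apply: qeval_zero.
have ext (A : gbaType) (f : X -> A) : exists h : G -> A,
    op_hom (fun S : gbaType => @sba_op_eval S) (fun S : gbaType => szero) h /\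
    forall x, h (j x) = f x.
  have [h [[[hM hJ hB h0] hi] _]] := free A f.
  by exists h; split=> //; split=> // -[].
have sba (A B : gbaType) (h : A -> B) :
    op_hom (fun S : gbaType => @sba_op_eval S) (fun S : gbaType => szero) h ->
    sba_hom h.
  by move=> [ho h0]; apply: op_hom_sba.
have [|atG topG] := @fresh_atomless_topless X G j.
  move=> c; have [x [xG xb]] := term_fresh surj c Xinf ext.
  exists x; split.
    by move=> e; have [h [/sba]] := xG e; exists h.
  have [|h [/sba]] := xb bool true; last by exists h.
  by move=> o; apply: sba_op_zero.
split=> //.
exact: (countable_terms_enumerable surj sba_op_code_inj).
Qed.

End FreeProperties.

(** * The isomorphism, from uniqueness of the countable atomless algebra without top *)

Local Open Scope classical_set_scope.

Theorem mainTheorem8 (X : Type)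
    (F : lsbiaType) (i : X -> F) (G : gbaType) (j : X -> G) :
  countable [set: X] -> infinite_set [set: X] ->
  free_lsbia i -> free_gba j ->
  gba_iso (Dquot F) G.
Proof.
move=> Xcount Xinf /(free_lsbia_properties Xcount Xinf) [eF aF tF].
move=> /(free_gba_properties Xcount Xinf) [eG aG tG].
apply: countable_atomless_topless_iso => //.
- exact: Dquot_enumerable.
- exact: Dquot_atomless.
- exact: Dquot_topless.
Qed.
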